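(* Let $(P,\le)$ be a finite poset. Then the free Boolean algebra $FB(P,\le)$ generated by the poset $(P,\le)$ has exactly $t$ atoms, where $t$ is the number of order filters $F$ of $(P,\le)$ with $\emptyset\subseteq F\subseteq P$ (both $\emptyset$ and $P$ are counted as order filters).
   Context: An order filter of a poset $(P,\le)$ is a subset $F\subseteq P$ such that $x\in F$ and $x\le y$ imply $y\in F$. A Boolean algebra is a Boolean lattice with $0,1$ as constants and complementation $x\mapsto\overline{x}$ as a unary operation; a Boolean homomorphism is a lattice homomorphism $\Phi$ with $\Phi(0)=0$, $\Phi(1)=1$ and $\Phi(\overline{x})=\overline{\Phi(x)}$. The free Boolean algebra $FB(P,\le)$ generated by the poset $(P,\le)$ is the up to isomorphism unique Boolean algebra such that: (a) $FB(P,\le)$ is generated, as a Boolean algebra, by $P$ (that is, $P$ is mapped by a monotone map into $FB(P,\le)$, and the image generates it under $\vee,\wedge,\overline{\phantom{x}},0,1$); (b) for each Boolean algebra $T$ and each monotone map $\phi:P\to T$ there is a Boolean homomorphism $\Phi:FB(P,\le)\to T$ that extends $\phi$. *)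

(* Defs.v *)
From HB Require Import structures.
From mathcomp Require Import all_boot all_order.

Set Implicit Arguments.
Unset Strict Implicit.
Unset Printing Implicit Defensive.

Import Order.TTheory.
Local Open Scope order_scope.

Definition order_filter (d : Order.disp_t) (P : finPOrderType d)
    (F : {set P}) : bool :=
  [forall x in F, forall y, (x <= y) ==> (y \in F)].

(* Boolean algebras are the ctbDistrLatticeTypes; the one-element algebra,
   where \bot = \top, is one of them. The library's {tblmorphism B -> T} is not
   used because it only bundles the preservation of \bot and \top. *)
Definition boolean_hom (d d' : Order.disp_t) (B : ctbDistrLatticeType d)
    (T : ctbDistrLatticeType d') (Phi : B -> T) : Prop :=
  [/\ {morph Phi : x y / x `|` y},
      {morph Phi : x y / x `&` y},
      Phi \bot = \bot,
      Phi \top = \top &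
      {morph Phi : x / ~` x}].

Inductive boolean_closure (d : Order.disp_t) (B : ctbDistrLatticeType d)
    (S : B -> Prop) : B -> Prop :=
| closure_gen x : S x -> boolean_closure S x
| closure_bot : boolean_closure S \bot
| closure_top : boolean_closure S \top
| closure_join x y :
    boolean_closure S x -> boolean_closure S y -> boolean_closure S (x `|` y)
| closure_meet x y :
    boolean_closure S x -> boolean_closure S y -> boolean_closure S (x `&` y)
| closure_compl x : boolean_closure S x -> boolean_closure S (~` x).

(* (B, eta) is a free Boolean algebra generated by the poset P; uniqueness of
   the extension Phi follows from free_generated. *)
Record is_free_boolean_algebra (d d' : Order.disp_t) (P : porderType d)
    (B : ctbDistrLatticeType d') (eta : P -> B) : Prop := {
  free_monotone : {homo eta : x y / x <= y};
  free_generated :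
    forall b : B, boolean_closure (fun x => exists p : P, x = eta p) b;
  free_extension :
    forall (dT : Order.disp_t) (T : ctbDistrLatticeType dT) (phi : P -> T),
      {homo phi : x y / x <= y} ->
      exists2 Phi : B -> T, boolean_hom Phi & forall p, Phi (eta p) = phi p
}.

Definition atom (d : Order.disp_t) (B : ctbDistrLatticeType d) (a : B) : Prop :=
  a <> \bot /\ forall x : B, x <= a -> x = \bot \/ x = a.

(* B is not assumed finite, so the cardinality of a subset of B is given by a
   duplicate-free enumeration. *)
Definition has_exactly (T : eqType) (n : nat) (A : T -> Prop) : Prop :=
  exists s : seq T, [/\ uniq s, size s = n & forall x, x \in s <-> A x].

(* Main.v *)
Require Import Defs.
From mathcomp Require Import all_boot all_order.

(** Each set [S] of points of [P] determines the minterm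
    [minterm eta S], the meet of all [eta p] with [p \in S] and all
    complements [~` eta p] with [p \notin S].  The atoms of the free algebra are
    the minterms of the order filters, and distinct filters have distinct
    minterms.

    Because [eta] generates the algebra, a minterm decides every element: it
    lies below that element or below its complement ([minterm_decides]).  So a
    minterm is an atom as soon as it is not [\bot] ([minterm_atom]).  Freeness
    is what makes the minterms of filters nonzero and distinct: if [F] is a
    filter, its indicator is a monotone map into the two-element algebra, and
    the homomorphism that extends it sends [minterm eta F] to [true] and every
    other minterm to [false] ([filter_valuation]).  Conversely, an atom [a] lies
    below [eta p] or below its complement for each [p], so it lies below the
    minterm of [[set p | a <= eta p]]; that set is a filter by monotonicity of
    [eta], its minterm is therefore an atom, and the two atoms coincide
    ([atom_minterm]). *)

Set Implicit Arguments.
Unset Strict Implicit.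
Unset Printing Implicit Defensive.

Import Order.Theory.
Local Open Scope order_scope.

Section Minterms.

Variables (P : finType) (d : Order.disp_t) (B : ctbDistrLatticeType d).
Implicit Types (eta : P -> B) (S : {set P}) (a b : B).

Definition minterm eta S : B :=
  \meet_p (if p \in S then eta p else ~` eta p).

Lemma minterm_le_mem eta S p : p \in S -> minterm eta S <= eta p.
Proof. by move=> pS; apply: (@meets_max _ _ _ p) => //; rewrite pS. Qed.

Lemma minterm_le_notin eta S p : p \notin S -> minterm eta S <= ~` eta p.
Proof.
by move=> /negPf pS; apply: (@meets_max _ _ _ p) => //; rewrite pS.
Qed.

(** The elements decided by a fixed minterm contain the generators and are
    closed under the Boolean operations. *)
Lemma minterm_decides eta S b :
    boolean_closure (fun x => exists p, x = eta p) b ->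
  (minterm eta S <= b) || (minterm eta S <= ~` b).
Proof.
elim=> [_ [p ->]|||x y _ IHx _ IHy|x y _ IHx _ IHy|x _ IHx].
- have [pS|pS] := boolP (p \in S); first by rewrite minterm_le_mem.
  by rewrite minterm_le_notin ?orbT.
- by rewrite compl0 lex1 orbT.
- by rewrite lex1.
- rewrite complU lexI.
  case/orP: IHx => [h|->]; first by rewrite (le_trans h (leUl _ _)).
  by case/orP: IHy => [h|->]; [rewrite (le_trans h (leUr _ _)) | rewrite orbT].
- rewrite complI lexI.
  case/orP: IHx => [->|h]; last by rewrite (le_trans h (leUl _ _)) orbT.
  by case/orP: IHy => [->|h] //; rewrite (le_trans h (leUr _ _)) orbT.
- by rewrite complK orbC.
Qed.

Lemma minterm_atom eta S :
    (forall b, boolean_closure (fun x => exists p, x = eta p) b) ->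
  minterm eta S <> \bot -> atom (minterm eta S).
Proof.
move=> gen nz; split=> // x xm.
have /orP[mx|mNx] := minterm_decides S (gen x).
  by right; apply/le_anti/andP.
(* x lies below its own complement, hence is zero *)
left; apply/eqP; rewrite -lex0 -(meetxC x) lexI lexx.
exact: le_trans xm mNx.
Qed.

Lemma atom_le_or_le_compl a b : atom a -> (a <= b) || (a <= ~` b).
Proof.
case=> _ /(_ (a `&` b) (leIl _ _)) [ab0|aba]; apply/orP.
  by right; rewrite -disj_leC; apply/eqP.
by left; rewrite -aba leIr.
Qed.

Lemma atom_le_minterm eta a :
  atom a -> a <= minterm eta [set p | a <= eta p].
Proof.
move=> aa; apply/meetsP => p _; rewrite inE.
case: ifP => // aNp.
by have := atom_le_or_le_compl (eta p) aa; rewrite aNp.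
Qed.

Lemma atom_le_atom a b : atom a -> atom b -> a <= b -> a = b.
Proof. by move=> [nz _] [_ min] /min []. Qed.

(** A homomorphism to the two-element algebra is a point of the Stone space;
    it is in exactly one minterm, that of the generators which it sends to
    [true]. *)
Lemma valuation_minterm eta (Phi : B -> bool) S S' :
    boolean_hom Phi -> (forall p, Phi (eta p) = (p \in S)) ->
  Phi (minterm eta S') = (S' == S).
Proof.
case=> _ PhiI _ Phi1 PhiC PhiE.
rewrite /minterm (big_morph Phi PhiI Phi1).
apply/idP/eqP => [h|->].
  (* [h] is read as [true <= \meet_p _], so that each factor is [true] *)
  have := lexx true; rewrite -[X in _ <= X]h => /meetsP {}h.
  apply/setP => p; have := h p isT.
  by case: (p \in S'); rewrite ?PhiC PhiE; case: (p \in S).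
rewrite (_ : \meet_p _ = \top) //.
apply: big1 => p _.
by case: ifP => pS; rewrite ?PhiC PhiE pS.
Qed.

End Minterms.

Section FreeBooleanAlgebra.

Variables (d d' : Order.disp_t) (P : finPOrderType d).
Variables (B : ctbDistrLatticeType d') (eta : P -> B).
Hypothesis freeB : is_free_boolean_algebra eta.
Implicit Types (F S : {set P}) (a : B).

Lemma filter_valuation F : order_filter F ->
  exists2 Phi : B -> bool,
    boolean_hom Phi & forall S, Phi (minterm eta S) = (S == F).
Proof.
move=> /forall_inP Ff.
have mono : {homo (fun p => p \in F) : x y / x <= y}.
  move=> x y xy; rewrite leEbool; have [xF|//] := boolP (x \in F).
  by have /forallP/(_ y) := Ff x xF; rewrite xy /= => ->.
have [Phi PhiH PhiE] := free_extension freeB mono.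
by exists Phi => // S; apply: valuation_minterm.
Qed.

Lemma filter_minterm_atom F : order_filter F -> atom (minterm eta F).
Proof.
move=> /filter_valuation[Phi [_ _ Phi0 _ _] PhiE].
apply: minterm_atom (free_generated freeB) _ => m0.
by have := PhiE F; rewrite m0 Phi0 eqxx.
Qed.

Lemma filter_minterm_inj :
  {in [pred F | order_filter F] &, injective (minterm eta)}.
Proof.
move=> F G /filter_valuation[Phi _ PhiE] _ eqFG.
by apply/esym/eqP; rewrite -PhiE -eqFG PhiE.
Qed.

Lemma filter_of_element a : order_filter [set p | a <= eta p].
Proof.
apply/forall_inP => x; rewrite inE => ax.
apply/forallP => y; apply/implyP => xy; rewrite inE.
exact: le_trans ax (free_monotone freeB xy).
Qed.

Lemma atom_minterm a : atom a -> a = minterm eta [set p | a <= eta p].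
Proof.
move=> aa; apply: atom_le_atom (atom_le_minterm eta aa) => //.
exact/filter_minterm_atom/filter_of_element.
Qed.

End FreeBooleanAlgebra.

Theorem theorem5 (d d' : Order.disp_t) (P : finPOrderType d)
    (B : ctbDistrLatticeType d') (eta : P -> B) :
  is_free_boolean_algebra eta ->
  has_exactly #|[set F : {set P} | order_filter F]| (@atom d' B).
Proof.
move=> freeB.
exists [seq minterm eta F | F <- enum [set F : {set P} | order_filter F]].
split.
- rewrite map_inj_in_uniq ?enum_uniq // => F G.
  rewrite !mem_enum !inE; exact: filter_minterm_inj.
- by rewrite size_map -cardE.
- move=> a; split=> [/mapP[F]|aa].
    by rewrite mem_enum inE => Ff ->; apply: filter_minterm_atom.
  apply/mapP; exists [set p | a <= eta p]; last exact: atom_minterm.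
  by rewrite mem_enum inE filter_of_element.
Qed.
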